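(* Let $W=\bigoplus_{k\ge-1}W^k$ be a $\mathbb Z$-graded Lie superalgebra. Suppose that $K$ and $H$ are compatible Poisson structures, i.e., odd elements of $W^1$ such that $[H,H]=[K,K]=[K,H]=0$. Assume, moreover, that $$\ker\big(\operatorname{ad}K|_{W^0_{\bar0}}\big)\subset[K,W^{-1}_{\bar1}]$$ (i.e., the even part of the first cohomology of the complex $(W,\operatorname{ad}K)$ vanishes). Then, if $h_0,\dots,h_N\in\Pi W^{-1}$, $N\ge1$, are even elements satisfying $$[H,h_n]=[K,h_{n+1}]\qquad\text{for all }n=0,\dots,N-1,$$ there exists an even element $h_{N+1}\in\Pi W^{-1}$ such that $[H,h_N]=[K,h_{N+1}]$.
   Context: The base field has characteristic $0$. $W$ is a $\mathbb Z$-graded Lie superalgebra with parity denoted $\bar p$; $W^k_{\bar0},W^k_{\bar1}$ are the even and odd parts of $W^k$ with respect to $\bar p$. $\Pi W^{-1}$ is $W^{-1}$ with the opposite parity $p=1-\bar p$, so an even element of $\Pi W^{-1}$ is an odd element of $W^{-1}$. All brackets are computed in $W$. *)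

(* Defs.v *)
From HB Require Import structures.
From mathcomp Require Import all_boot all_order all_algebra.

Set Implicit Arguments.
Unset Strict Implicit.
Unset Printing Implicit Defensive.

Import Order.TTheory GRing.Theory Num.Theory.
Local Open Scope ring_scope.

Definition internal_direct_sum (F : fieldType) (V : lmodType F) (I : eqType)
    (U : I -> {pred V}) : Prop :=
  [/\ forall i, submod_closed (U i),
      forall x : V, exists s : seq I, exists2 c : I -> V,
        (forall i, c i \in U i) & x = \sum_(i <- s) c i
    & forall (s : seq I) (c : I -> V), uniq s -> (forall i, c i \in U i) ->
        \sum_(i <- s) c i = 0 -> forall i, i \in s -> c i = 0].

(* Parities are booleans: false is even, true is odd, and addition in Z/2 is  *)
(* addb.                                                                      *)
HB.mixin Record isLieSuperalgebra (F : fieldType) W of GRing.Lmodule F W := {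
  parity_part : bool -> {pred W};
  lie : W -> W -> W;
  parity_part_dsum : internal_direct_sum parity_part;
  lie_linear_r : forall x : W, linear (lie x);
  lie_linear_l : forall y : W, linear (lie^~ y);
  lie_parity : forall (p q : bool) (x y : W),
    x \in parity_part p -> y \in parity_part q ->
    lie x y \in parity_part (p (+) q);
  lie_skew : forall (p q : bool) (x y : W),
    x \in parity_part p -> y \in parity_part q ->
    lie x y = - ((-1 : F) ^+ (p && q) *: lie y x);
  lie_jacobi : forall (p q : bool) (x y z : W),
    x \in parity_part p -> y \in parity_part q ->
    lie x (lie y z) = lie (lie x y) z + (-1 : F) ^+ (p && q) *: lie y (lie x z)
}.

#[short(type="lieSuperalgType")]
HB.structure Definition LieSuperalgebra (F : fieldType) :=
  {W of isLieSuperalgebra F W & GRing.Lmodule F W}.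

(* The axiom degree_part_parity says that each W^k is a sub-superspace:       *)
(* W^k = W^k_0 + W^k_1.                                                       *)
HB.mixin Record isZGraded (F : fieldType) W of LieSuperalgebra F W := {
  degree_part : int -> {pred W};
  degree_part_dsum : internal_direct_sum degree_part;
  degree_part_parity : forall (k : int) (x : W), x \in degree_part k ->
    exists2 c : bool -> W,
      (forall p, c p \in degree_part k /\ c p \in parity_part p)
      & x = c false + c true;
  lie_degree : forall (i j : int) (x y : W),
    x \in degree_part i -> y \in degree_part j ->
    lie x y \in degree_part (i + j)
}.

#[short(type="zgradedLieSuperalgType")]
HB.structure Definition ZGradedLieSuperalgebra (F : fieldType) :=
  {W of isZGraded F W & LieSuperalgebra F W}.

Notation "[ 'lie' x , y ]" := (lie x y)
  (at level 0, x, y at level 99, format "[ 'lie'  x ,  y ]") : ring_scope.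

Section Homogeneous.

Variables (F : fieldType) (W : zgradedLieSuperalgType F).

Definition homog (k : int) (p : bool) : {pred W} :=
  [pred x | (x \in degree_part k) && (x \in parity_part p)].

(* Parity in Pi W^{-1} is opposite to the parity of W. *)
Definition Pi_homog (p : bool) : {pred W} := homog (-1) (~~ p).

Definition ad (x : W) : W -> W := fun y => [lie x, y].

Definition Poisson_structure (H : W) : Prop :=
  H \in homog 1 true /\ [lie H, H] = 0.

Definition compatible_Poisson (K H : W) : Prop :=
  [/\ Poisson_structure K, Poisson_structure H & [lie K, H] = 0].

End Homogeneous.

Arguments homog {F} W k p.
Arguments Pi_homog {F} W p.

(* Main.v *)
Require Import Defs.
From HB Require Import structures.
From mathcomp Require Import all_boot all_order all_algebra.
Import Order.TTheory GRing.Theory Num.Theory.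
Local Open Scope ring_scope.

(** By the vanishing of cohomology it suffices that [H, h_N] be an even element
    of W^0 killed by ad K.  As K and H are odd and [K, H] = 0, the operators
    ad K and ad H anticommute, so
      [K, [H, h_N]] = - [H, [K, h_N]] = - [H, [H, h_{N-1}]],
    where the recursion is used once, at n = N-1.  The last term is zero: as
    [H, H] = 0, ad H anticommutes with itself, whence (ad H)^2 = 0 because 2 is
    invertible. *)

Section OddElements.

Context {F : fieldType} {W : lieSuperalgType F}.

Lemma lie0l (y : W) : [lie 0, y] = 0.
Proof.
by have := lie_linear_l y (-1) 0 0; rewrite /= scaler0 addr0 scaleN1r addNr.
Qed.

Lemma lie_odd_anticomm {x y : W} (z : W) :
  x \in parity_part true -> y \in parity_part true -> [lie x, y] = 0 ->
  [lie x, [lie y, z]] = - [lie y, [lie x, z]].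
Proof.
move=> x_odd y_odd xy0.
by rewrite (lie_jacobi _ _ _ _ z x_odd y_odd) xy0 lie0l add0r expr1 scaleN1r.
Qed.

Lemma lie_odd_square0 (x z : W) :
  (2%:R : F) != 0 -> x \in parity_part true -> [lie x, x] = 0 ->
  [lie x, [lie x, z]] = 0.
Proof.
move=> two_neq0 x_odd xx0; apply/eqP.
rewrite -[_ == 0]orFb -(negPf two_neq0) -scaler_eq0 scaler_nat mulr2n.
by rewrite {1}(lie_odd_anticomm z x_odd x_odd xx0) addNr.
Qed.

End OddElements.

Theorem theorem8p4 (F : fieldType) (charF0 : [pchar F] =i pred0)
    (W : zgradedLieSuperalgType F)
    (W_ge_m1 : forall (k : int) (x : W),
       k < -1 -> x \in degree_part k -> x = 0)
    (K H : W) (KH : compatible_Poisson K H)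
    (kerK : forall x : W, x \in homog W 0 false -> ad K x = 0 ->
       exists2 y : W, y \in homog W (-1) true & x = [lie K, y])
    (N : nat) (N_ge1 : (1 <= N)%N) (h : nat -> W)
    (h_even : forall n : nat, (n <= N)%N -> h n \in Pi_homog W false)
    (h_rec : forall n : nat, (n < N)%N -> [lie H, h n] = [lie K, h n.+1]) :
  exists2 hN1 : W, hN1 \in Pi_homog W false & [lie H, h N] = [lie K, hN1].
Proof.
case: KH => -[/andP[_ K_odd] _] [/andP[H_deg1 H_odd] HH0] KH0.
have two_neq0 : (2%:R : F) != 0.
  by have := charF0 2; rewrite !inE /= => ->.
have /andP[hN_deg hN_odd] := h_even N (leqnn N).
apply: kerK.
  apply/andP; split; last exact: lie_parity _ _ _ _ H_odd hN_odd.
  by have := lie_degree _ _ _ _ H_deg1 hN_deg; rewrite subrr.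
rewrite /ad (lie_odd_anticomm (h N) K_odd H_odd KH0).
case: N N_ge1 h_rec {h_even hN_deg hN_odd} => // n _ h_rec.
by rewrite -(h_rec n (ltnSn n)) lie_odd_square0 // oppr0.
Qed.
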